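(* Let $\mathcal{T}$ be a countable directed poset and let $G:\mathcal{T}\to\mathrm{Grp}$ be a diagram of perfect groups that satisfies the Mittag-Leffler condition. Then $\mathrm{Ab}(\lim_{t\in\mathcal{T}}G_t)$ is a cotorsion group.
   Context: A poset $\mathcal{T}$ is viewed as a category with a single morphism $t\to s$ whenever $t\geq s$; so a diagram $G:\mathcal{T}\to\mathrm{Grp}$ (a functor to the category of groups) consists of groups $G_t$ and compatible homomorphisms $G_t\to G_s$ for $t\ge s$, and $\lim$ is the inverse limit. $\mathcal{T}$ is directed if for all $t,s\in\mathcal{T}$ there is $r\in\mathcal{T}$ with $r\geq t$ and $r\geq s$. Mittag-Leffler condition: for every $t\in\mathcal{T}$ there exists $s\geq t$ such that for every $r\geq s$ we have $\mathrm{Im}(G_s\to G_t)=\mathrm{Im}(G_r\to G_t)$. For a group $G$, $\mathrm{Ab}(G)=G/\mathrm{C}(G)$, where $\mathrm{C}(G)$ is the commutator subgroup of $G$. A group $G$ is perfect if $\mathrm{Ab}(G)=0$. An abelian group $A$ is cotorsion if $\mathrm{Ext}(\mathbb{Q},A)=0$, i.e. for every abelian group $B$ containing $A$ as a subgroup with $B/A\cong\mathbb{Q}$, $A$ is a direct summand of $B$. *)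

(* Defs.v *)
From HB Require Import structures.
From mathcomp Require Import all_boot all_order all_algebra.
From mathcomp Require Import boolp classical_sets functions cardinality.

Set Implicit Arguments.
Unset Strict Implicit.
Unset Printing Implicit Defensive.

Import Order.TTheory GRing.Theory.
Local Open Scope classical_set_scope.
Local Open Scope quotient_scope.
Local Open Scope order_scope.
Local Open Scope group_scope.

Definition directed (disp : Order.disp_t) (T : porderType disp) : Prop :=
  forall t s : T, exists r : T, t <= r /\ s <= r.

(* Order proofs are proofs of boolean equalities, hence unique, so [dmap] is
   one homomorphism for each pair t >= s. *)
Record diagram (disp : Order.disp_t) (T : porderType disp) := Diagram {
  dobj :> T -> groupType;
  dmap : forall t s : T, s <= t -> UMagmaMorphism.type (dobj t) (dobj s);
  dmap_id : forall (t : T) (tt : t <= t) (x : dobj t), dmap tt x = x;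
  dmap_comp : forall (t s r : T) (st : s <= t) (rs : r <= s) (rt : r <= t)
    (x : dobj t), dmap rt x = dmap rs (dmap st x)
}.

Definition mittag_leffler (disp : Order.disp_t) (T : porderType disp)
    (G : diagram T) : Prop :=
  forall t : T, exists (s : T) (ts : t <= s),
    forall (r : T) (sr : s <= r) (tr : t <= r),
      range (dmap G ts) = range (dmap G tr).

Definition prod_group (I : Type) (G : I -> groupType) : Type :=
  forall i : I, G i.

Section ProdGroup.
Variables (I : Type) (G : I -> groupType).
Implicit Types x y z : prod_group G.

Definition prod_mul x y : prod_group G := fun i => x i * y i.
Definition prod_one : prod_group G := fun i => 1.
Definition prod_inv x : prod_group G := fun i => (x i)^-1.

Fact prod_mulA : associative prod_mul.
Proof. by move=> x y z; apply: functional_extensionality_dep => i; apply: mulgA. Qed.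
Fact prod_mul1g : left_id prod_one prod_mul.
Proof. by move=> x; apply: functional_extensionality_dep => i; apply: mul1g. Qed.
Fact prod_mulg1 : right_id prod_one prod_mul.
Proof. by move=> x; apply: functional_extensionality_dep => i; apply: mulg1. Qed.
Fact prod_mulVg : left_inverse prod_one prod_inv prod_mul.
Proof. by move=> x; apply: functional_extensionality_dep => i; apply: mulVg. Qed.
Fact prod_mulgV : right_inverse prod_one prod_inv prod_mul.
Proof. by move=> x; apply: functional_extensionality_dep => i; apply: mulgV. Qed.

HB.instance Definition _ := Choice.copy (prod_group G) (forall i : I, G i).
HB.instance Definition _ := isGroup.Build (prod_group G)
  prod_mulA prod_mul1g prod_mulg1 prod_mulVg prod_mulgV.
End ProdGroup.

Section Lim.
Variables (disp : Order.disp_t) (T : porderType disp) (G : diagram T).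

Definition compatible : pred (prod_group G) :=
  fun x => `[< forall (t s : T) (st : s <= t), dmap G st (x t) = x s >].

Record inv_lim := InvLim { inv_lim_val : prod_group G; _ : compatible inv_lim_val }.

Fact compatible_group_closed : group_closed compatible.
Proof.
split=> [|x y /asboolP xP /asboolP yP]; apply/asboolP => t s st.
  exact: gmulf1.
by rewrite [LHS]gmulfF xP yP.
Qed.

HB.instance Definition _ := [isSub for inv_lim_val].
HB.instance Definition _ := [Choice of inv_lim by <:].
HB.instance Definition _ := SubChoice_isSubGroup.Build (prod_group G) compatible
  inv_lim compatible_group_closed.
End Lim.

Definition commutator_subgroup (G : groupType) : set G :=
  smallest (fun H : set G => group_closed (mem H))
           [set z | exists x y : G, z = [~ x, y]].

Arguments commutator_subgroup : clear implicits.

Section Ab.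
Variable G : groupType.
Local Notation C := (commutator_subgroup G).

Lemma commutator_subgroup1 : C 1.
Proof. by move=> H [[/set_mem H1 _] _]. Qed.

Lemma commutator_subgroupF x y : C x -> C y -> C (x / y).
Proof.
move=> Cx Cy H /[dup] HP [[_ HF] _]; apply/set_mem/HF; apply/mem_set.
  exact: Cx.
exact: Cy.
Qed.

Lemma commutator_subgroupR x y : C [~ x, y].
Proof. by move=> H [_]; apply; exists x, y. Qed.

Lemma commutator_subgroupV x : C x -> C x^-1.
Proof. by move=> /(commutator_subgroupF commutator_subgroup1); rewrite div1g. Qed.

Lemma commutator_subgroupM x y : C x -> C y -> C (x * y).
Proof. by move=> Cx /commutator_subgroupV /(commutator_subgroupF Cx); rewrite invgK. Qed.

Definition Ab_eq : rel G := fun x y => `[< C (x / y) >].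

Fact Ab_eq_equiv : equiv_class_of Ab_eq.
Proof.
split=> [x|x y|y x z].
- by apply/asboolP; rewrite divgg; apply: commutator_subgroup1.
- by apply/asbool_equiv_eq; split=> /commutator_subgroupV; rewrite invgF.
- move=> /asboolP xy /asboolP yz; apply/asboolP.
  by rewrite -(divgKA y); apply: commutator_subgroupM.
Qed.

Canonical Ab_eq_equiv_rel := EquivRelPack Ab_eq_equiv.
Canonical Ab_eq_encModRel := defaultEncModRel Ab_eq.

(* Written additively, so that Ab G is a [zmodType]. *)
Definition Ab : Type := {eq_quot Ab_eq}.

HB.instance Definition _ : EqQuotient G Ab_eq Ab := EqQuotient.on Ab.
HB.instance Definition _ := Choice.on Ab.

Lemma Ab_piP x y : (\pi_Ab x = \pi_Ab y) <-> C (x / y).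
Proof.
split=> [/eqP|xy]; first by rewrite piE => /asboolP.
by apply/eqP; rewrite piE; apply/asboolP.
Qed.

Definition Ab_zero : Ab := \pi_Ab 1.
Definition Ab_opp (a : Ab) : Ab := \pi_Ab (repr a)^-1.
Definition Ab_add (a b : Ab) : Ab := \pi_Ab (repr a * repr b).

Lemma Ab_pi_mulC x y : \pi_Ab (x * y) = \pi_Ab (y * x).
Proof. by apply/Ab_piP; rewrite (commgCV x y) mulgK; apply: commutator_subgroupR. Qed.

Lemma Ab_pi_mull x x' y : \pi_Ab x = \pi_Ab x' -> \pi_Ab (x * y) = \pi_Ab (x' * y).
Proof. by move=> /Ab_piP xx'; apply/Ab_piP; rewrite mulgKA. Qed.

Lemma Ab_piM x y : \pi_Ab (x * y) = Ab_add (\pi_Ab x) (\pi_Ab y).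
Proof.
rewrite /Ab_add (Ab_pi_mull _ (esym (reprK (\pi_Ab x)))) Ab_pi_mulC [RHS]Ab_pi_mulC.
by apply: Ab_pi_mull; rewrite reprK.
Qed.

Fact Ab_addA : associative Ab_add.
Proof.
move=> a b c; rewrite -[a]reprK -[b]reprK -[c]reprK.
rewrite -(Ab_piM (repr a) (repr b)) -(Ab_piM (repr b) (repr c)).
by rewrite -(Ab_piM (repr a)) -(Ab_piM _ (repr c)) mulgA.
Qed.
Fact Ab_addC : commutative Ab_add.
Proof. by move=> a b; apply: Ab_pi_mulC. Qed.
Fact Ab_add0 : left_id Ab_zero Ab_add.
Proof. by move=> a; rewrite -[a in LHS]reprK -(Ab_piM 1) mul1g reprK. Qed.
Fact Ab_addN : left_inverse Ab_zero Ab_opp Ab_add.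
Proof. by move=> a; rewrite -[a in X in Ab_add _ X]reprK -(Ab_piM _ (repr a)) mulVg. Qed.

HB.instance Definition _ := GRing.isZmodule.Build Ab Ab_addA Ab_addC Ab_add0 Ab_addN.
End Ab.

Definition perfect (G : groupType) : Prop := forall a : Ab G, a = 0%R.

Definition direct_summand (B : zmodType) (S : zmodClosed B) : Prop :=
  exists C : zmodClosed B,
    (forall b : B, b \in S -> b \in C -> b = 0%R) /\
    (forall b : B, exists a c : B, [/\ a \in S, c \in C & b = (a + c)%R]).

(* "B contains A as a subgroup" is rendered by an embedding i of A into B
   whose image is the subgroup S. *)
Definition cotorsion (A : zmodType) : Prop :=
  forall (B : zmodType) (S : zmodClosed B) (i : {additive A -> B}),
    injective i -> range i = [set` S] ->
    (exists f : {additive Quotient.quot S -> rat}, bijective f) ->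
    direct_summand S.

(* Main.v *)
Require Import Defs.
From HB Require Import structures.
From mathcomp Require Import all_boot all_order all_algebra.
From mathcomp Require Import boolp classical_sets functions cardinality.

(* An abelian group A is cotorsion as soon as every system x_n = a_n + (n+1) x_(n+1)
   is solvable in A: in an extension B of Q by A, lifts b_n of 1/n! satisfy
   b_n = (n+1) b_(n+1) - a_n with a_n in A, and a solution x corrects them to
   c_n = b_n + x_n with c_n = (n+1) c_(n+1), which generate a complement of A.

   For A = Ab(L) with L the limit, take a cofinal chain t_n such that the image of
   G_(t_(n+1)) in G_(t_n) is stable. Every element of a stable image lifts to L, so
   by perfectness each g_n in L is c_n k_n with c_n in [L, L] and k_n trivial
   in G_(t_n). The system x_n = k_n x_(n+1)^(n+1) then has an exact solution in L,
   the infinite product k_n (k_(n+1) (k_(n+2) ...)^(n+2))^(n+1). *)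

Local Open Scope classical_set_scope.

(** * Cotorsion from solvable systems *)

Section Cotorsion.
Local Open Scope ring_scope.
Import Order.TTheory GRing.Theory Num.Theory.

(** The union of the cyclic groups generated by the [c n]. It is a subgroup once each [c n] is a
    multiple of [c n.+1], and will serve as the complement of [S]. *)
Definition multiples {B : zmodType} (c : nat -> B) : pred B :=
  fun b => `[< exists n (z : int), b = c n *~ z >].

Section Multiples.
Context {B : zmodType} {c : nat -> B}.
Hypothesis cS : forall n, c n = c n.+1 *+ n.+1.

Lemma divisible_chainE n m : (n <= m)%N -> exists k : nat, c n = c m *+ k.
Proof.
elim: m => [|m IH]; first by rewrite leqn0 => /eqP ->; exists 1%N.
rewrite leq_eqVlt => /predU1P[->|]; first by exists 1%N.
by move=> /IH[k ->]; exists (m.+1 * k)%N; rewrite cS mulrnA.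
Qed.

Lemma multiples_zmod_closed : zmod_closed (multiples c).
Proof.
split=> [|x y /asboolP[n [z ->]] /asboolP[m [w ->]]]; apply/asboolP.
  by exists 0%N, 0; rewrite mulr0z.
have [k ->] := divisible_chainE _ _ (leq_maxl n m).
have [l ->] := divisible_chainE _ _ (leq_maxr n m).
exists (maxn n m), (k%:Z * z - l%:Z * w).
by rewrite mulrzBr !mulrzA !pmulrn.
Qed.

End Multiples.

Lemma cotorsion_of_solvable (A : zmodType) :
  (forall a : nat -> A, exists x : nat -> A,
     forall n, x n = a n + x n.+1 *+ n.+1) ->
  cotorsion A.
Proof.
move=> solvA B S i _ iS [f [g fK gK]].
(* [q] is the projection of [B] onto the rationals, with kernel [S]. *)
pose q (b : B) : rat := f (\pi_(Quotient.quot S) b)%qT.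
have qB x y : q (x - y) = q x - q y by rewrite /q !raddfB.
have q0 : q 0 = 0 by rewrite -(subrr 0) qB subrr.
have qN x : q (- x) = - q x by rewrite -sub0r qB q0 sub0r.
have qD x y : q (x + y) = q x + q y by rewrite -[y in LHS]opprK qB qN opprK.
have qMn x n : q (x *+ n) = q x *+ n.
  by elim: n => [|n IH]; rewrite ?mulr0n // !mulrS qD IH.
have qMz x z : q (x *~ z) = q x *~ z.
  by case: z => n; rewrite ?NegzE ?mulrNz ?qN -!pmulrn qMn.
have qS b : (b \in S) = (q b == 0).
  rewrite -[b in LHS]subr0 Quotient.idealrBE -(can_eq fK).
  by rewrite -!/(q _) q0.
have qsurj r : exists b, q b = r.
  by exists (repr (g r)); rewrite /q reprK gK.
have /choice[b qb] : forall n, exists b, q b = (n`!%:R)^-1 by move=> n.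
have factS n : (n`!%:R)^-1 = (n.+1`!%:R)^-1 *+ n.+1 :> rat.
  rewrite factS natrM invfM -[RHS]mulr_natl mulrA mulfV ?mul1r //.
  by rewrite pnatr_eq0.
have /choice[a ia] : forall n, exists a, i a = b n.+1 *+ n.+1 - b n.
  move=> n; have : b n.+1 *+ n.+1 - b n \in S.
    by rewrite qS qB qMn !qb -factS subrr.
  have : [set` S] = range i by [].
  by move=> /seteqP[SR _] /SR[a _ <-]; exists a.
have [x xE] := solvA a.
pose c n := b n + i (x n).
have qi y : q (i y) = 0.
  apply/eqP; rewrite -qS.
  have /seteqP[RS _] := iS.
  by apply: (RS (i y)); exists y.
have qc n : q (c n) = (n`!%:R)^-1 by rewrite qD qi addr0.
have cS n : c n = c n.+1 *+ n.+1.
  rewrite /c xE raddfD raddfMn ia mulrnDl.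
  by rewrite addrA [b n + _]addrC subrK.
pose C : zmodClosed B := HB.pack_for (zmodClosed B) (multiples c)
  (GRing.isZmodClosed.Build B (multiples c) (multiples_zmod_closed cS)).
exists C; split=> [y|y].
  (* [c n *~ z] has image [z / n!], which vanishes only for [z = 0]. *)
  rewrite qS => /eqP qy /asboolP[n [z yE]].
  move/eqP: qy; rewrite yE qMz qc.
  rewrite mulrz_eq0 [X in _ || X]invr_eq0 pnatr_eq0 -leqn0 leqNgt fact_gt0 orbF.
  by move=> /eqP ->; rewrite mulr0z.
(* The denominator [d] of [q y] divides [d!], so [q y] is an integer multiple, by [z], of the image
   [1 / d!] of [c d]. *)
pose d := `|denq (q y)|%N.
have d_gt0 : (0 < d)%N by rewrite absz_gt0 denq_neq0.
have [k fE] : exists k, d`! = (k * d)%N by apply/dvdnP/dvdn_fact; rewrite d_gt0 /=.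
have k_neq0 : k%:R != 0 :> rat.
  by rewrite pnatr_eq0; apply: contraL (fact_gt0 d) => /eqP k0; rewrite fE k0 mul0n.
pose z := numq (q y) * k%:Z.
exists (y - c d *~ z), (c d *~ z); split; last by rewrite subrK.
  rewrite qS qB qMz qc subr_eq0 fE natrM /z -[X in _ == X]mulrzl intrM -pmulrn.
  rewrite invfM mulrA mulfK // -[X in X == _]divq_num_den pmulrn.
  by rewrite gez0_abs ?ltW ?denq_gt0.
by apply/asboolP; exists d, z.
Qed.

End Cotorsion.

(** * Abelianization and the commutator subgroup *)

Section AbFacts.
Local Open Scope quotient_scope.

Lemma Ab_piD {G : groupType} (x y : G) :
  \pi_(Ab G) (x * y)%g = (\pi_(Ab G) x + \pi_(Ab G) y)%R.
Proof. exact: Ab_piM. Qed.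

Lemma Ab_piX {G : groupType} (x : G) n : \pi_(Ab G) (x ^+ n)%g = (\pi_(Ab G) x *+ n)%R.
Proof.
elim: n => [|n IH]; first by rewrite expg0 GRing.mulr0n.
by rewrite expgS GRing.mulrS Ab_piD IH.
Qed.

Lemma perfectP (G : groupType) :
  perfect G -> forall x : G, commutator_subgroup G x.
Proof.
move=> pG x; rewrite -[x]mulg1 -invg1; apply/Ab_piP.
by rewrite !(pG (\pi_(Ab G) _)).
Qed.

Lemma commutator_subgroup_ind (G : groupType) (P : set G) :
  P 1%g -> (forall x y, P x -> P y -> P (x / y)%g) ->
  (forall x y, P [~ x, y]%g) -> forall x, commutator_subgroup G x -> P x.
Proof.
move=> P1 PF PR x; apply; split=> [|_ [y [z ->]]]; last exact: PR.
by split=> [|y z /set_mem Py /set_mem Pz]; apply/mem_set; [|exact: PF].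
Qed.

End AbFacts.

(** The types depend on [n] because successive choices will lie in different groups of the
    diagram. *)
Lemma dependent_choice (X : nat -> Type) (R : forall n, X n -> X n.+1 -> Prop) x0 :
  (forall n x, exists y, R n x y) ->
  exists x : forall n, X n, x 0%N = x0 /\ forall n, R n (x n) (x n.+1).
Proof.
move=> RP; pose x := fix x n : X n :=
  if n is m.+1 then projT1 (cid (RP m (x m))) else x0.
by exists x; split=> // n; apply: (projT2 (cid (RP n (x n)))).
Qed.

(** * Inverse limits along a cofinal chain *)

Section Limit.
Local Open Scope order_scope.
Local Open Scope group_scope.
Import Order.TTheory.
Context {disp : Order.disp_t} {T : porderType disp} {G : diagram T}.
Local Notation L := (inv_lim G).
Implicit Types (x y : L).

Definition lim_proj t x : G t := inv_lim_val x t.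

Lemma lim_projM t x y : lim_proj t (x * y) = lim_proj t x * lim_proj t y.
Proof. by []. Qed.

Lemma lim_proj1 t : lim_proj t 1 = 1.
Proof. by []. Qed.

Lemma lim_projV t x : lim_proj t x^-1 = (lim_proj t x)^-1.
Proof. by []. Qed.

Lemma lim_projX t x n : lim_proj t (x ^+ n) = lim_proj t x ^+ n.
Proof.
elim: n => [|n IH]; first by rewrite !expg0 lim_proj1.
by rewrite !expgS lim_projM IH.
Qed.

Lemma dmap_proj t s (st : s <= t) x : dmap G st (lim_proj t x) = lim_proj s x.
Proof. by case: x => x /= /asboolP xP; apply: xP. Qed.

Lemma lim_ext x y : (forall t, lim_proj t x = lim_proj t y) -> x = y.
Proof.
by move=> xy; apply: val_inj; apply: functional_extensionality_dep => t; apply: xy.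
Qed.

Definition cofinal_chain (t : nat -> T) : Prop :=
  (forall n, t n <= t n.+1) /\ (forall s, exists n, s <= t n).

Lemma chain_le {t} : cofinal_chain t -> {homo t : m n / (m <= n)%N >-> m <= n}.
Proof. by case=> tS _; apply: homo_leq => // ? ? ?; apply: le_trans. Qed.

Lemma cofinal_chain_shift {t} n : cofinal_chain t -> cofinal_chain (fun k => t (k + n)%N).
Proof.
move=> tC; split=> [k|s]; first exact: tC.1.
have [k sk] := tC.2 s; exists k; apply: le_trans sk _.
by apply: (chain_le tC); apply: leq_addr.
Qed.

Lemma lim_ext_chain {t} x y : cofinal_chain t ->
  (forall n, lim_proj (t n) x = lim_proj (t n) y) -> x = y.
Proof.
move=> tC xy; apply: lim_ext => s; have [n sn] := tC.2 s.
by rewrite -!(dmap_proj _ _ sn) xy.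
Qed.

Lemma lim_of_chain {t} (tC : cofinal_chain t) (y : forall n, G (t n)) :
  (forall n, dmap G (tC.1 n) (y n.+1) = y n) ->
  exists x : L, forall n, lim_proj (t n) x = y n.
Proof.
move=> yS.
have yP m n (mn : (m <= n)%N) (tmn : t m <= t n) : dmap G tmn (y n) = y m.
  elim: n mn tmn => [|n IH] mn tmn.
    by move: mn tmn; rewrite leqn0 => /eqP -> tmn; rewrite dmap_id.
  move: mn; rewrite leq_eqVlt => /predU1P[mn|mn].
    by subst m; rewrite dmap_id.
  have tmn' := chain_le tC m n mn.
  by rewrite (dmap_comp (tC.1 n) tmn') yS IH.
have yE s m n (sm : s <= t m) (sn : s <= t n) : dmap G sm (y m) = dmap G sn (y n).
  wlog mn : m n sm sn / (m <= n)%N.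
    by move=> H; case/orP: (leq_total m n) => ?; [|symmetry]; apply: H.
  by rewrite -(yP _ _ mn (chain_le tC _ _ mn)) -dmap_comp.
(* Any stage above [s] may be chosen: by [yE] the value does not depend on it. *)
pose x (s : T) : G s := let sn := projT2 (cid (tC.2 s)) in dmap G sn (y _).
have xP : compatible x.
  apply/asboolP => s r rs; rewrite /x.
  by rewrite -(dmap_comp _ _ (le_trans rs (projT2 (cid (tC.2 s))))); apply: yE.
exists (InvLim xP) => n; rewrite /lim_proj /= /x.
by rewrite (yE _ _ n _ (lexx _)) dmap_id.
Qed.

Definition stable_at {t s} (ts : t <= s) : Prop :=
  forall r (sr : s <= r) (tr : t <= r), range (dmap G ts) = range (dmap G tr).

Definition stable_chain (t : nat -> T) (tC : cofinal_chain t) : Prop :=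
  forall n, stable_at (tC.1 n).

(** Stage [n] takes an index stable for [t n] and raises it above the element of code [n], if any.
    Raising keeps stability; running through all codes gives cofinality. *)
Lemma exists_stable_chain :
  countable [set: T] -> directed T -> mittag_leffler G -> T ->
  exists (t : nat -> T) (tC : cofinal_chain t), stable_chain t tC.
Proof.
move=> /countable_injP[code codeI] dT ml t0.
have step (p : nat * T) : exists s (ts : p.2 <= s),
    stable_at ts /\ forall u, code u = p.1 -> u <= s.
  case: p => n t; have [s [ts sP]] := ml t.
  have [r [sr ur]] : exists r, s <= r /\ forall u, code u = n -> u <= r.
    have [[u uE]|nu] := pselect (exists u, code u = n).
      have [r [sr ur]] := dT s u; exists r; split=> // v vE.
      by have -> : v = u by apply: codeI; rewrite ?inE // uE.
    by exists s; split=> // u uE; case: nu; exists u.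
  exists r, (le_trans ts sr); split=> // q rq tq.
  by rewrite -(sP r sr) (sP q (le_trans sr rq) tq).
have [next nextP] := choice step.
pose t := fix t n := if n is m.+1 then next (m, t m) else t0.
have tC : cofinal_chain t.
  split=> [n|s]; first by have [] := nextP (n, t n).
  by exists (code s).+1; have [_ [_]] := nextP (code s, t (code s)); apply.
exists t, tC => n; have [tn [tnP _]] := nextP (n, t n).
by rewrite (bool_irrelevance (tC.1 n) tn).
Qed.

Section StableChain.
Context {t : nat -> T} {tC : cofinal_chain t} (tP : stable_chain t tC).

(** Consecutive stable images map onto one another, so an element of one lifts step by step along
    the chain. *)
Lemma lim_proj_stable n (y : G (t n.+1)) :
  exists x : L, lim_proj (t n) x = dmap G (tC.1 n) y.
Proof.
pose X k := {z : G (t (k + n)%N) | range (dmap G (tC.1 (k + n)%N)) z}.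
pose R k (z : X k) (z' : X k.+1) := dmap G (tC.1 (k + n)%N) (sval z') = sval z.
have RP k z : exists z', R k z z'.
  case: z => z zR; rewrite /R /=.
  have rr := le_trans (tC.1 (k + n)%N) (tC.1 (k + n).+1).
  (* By stability [z] comes from some [v] two steps up; the image of [v] one step up is a preimage
     of [z] in the next stable image. *)
  move: (zR); rewrite (tP _ _ (tC.1 (k + n).+1) rr) => -[v _ vz].
  have vR : range (dmap G (tC.1 (k.+1 + n)%N)) (dmap G (tC.1 (k + n).+1) v).
    by exists v.
  by exists (exist _ _ vR); rewrite /= -(dmap_comp _ _ rr).
have y0 : range (dmap G (tC.1 n)) (dmap G (tC.1 n) y) by exists y.
have [z [z0 zS]] := dependent_choice X R (exist _ _ y0) RP.
have sC := cofinal_chain_shift n tC.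
have [k|x xz] := lim_of_chain sC (fun k => sval (z k)).
  by rewrite (bool_irrelevance (sC.1 k) (tC.1 (k + n)%N)) (zS k).
by exists x; rewrite (xz 0%N) z0.
Qed.

(* [G (t n)] need not be the image of the limit, so perfectness is used one step
   further along the chain, where commutators do lift to the limit. *)
Lemma lim_proj_commutator : (forall s, perfect (G s)) ->
  forall n x, exists2 c, commutator_subgroup L c & lim_proj (t n) c = lim_proj (t n) x.
Proof.
move=> pG n x; rewrite -(dmap_proj _ _ (tC.1 n) x).
pose P (h : G (t n.+1)) :=
  exists2 c, commutator_subgroup L c & lim_proj (t n) c = dmap G (tC.1 n) h.
apply: (commutator_subgroup_ind _ P); last exact: perfectP.
- by exists 1; [exact: commutator_subgroup1 | rewrite gmulf1].
- move=> h k [c Cc ch] [d Cd dk]; exists (c / d); first exact: commutator_subgroupF.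
  by rewrite lim_projM lim_projV ch dk gmulfF.
move=> h k; have [[c ch] [d dk]] := (lim_proj_stable n h, lim_proj_stable n k).
exists [~ c, d]; first exact: commutator_subgroupR.
by rewrite gmulfR -ch -dk.
Qed.

End StableChain.

(** In [G (t j)] only the factors [k n] with [n < j] can be nontrivial, so the infinite product
    makes sense in the limit. *)
Lemma lim_solve {t} (tC : cofinal_chain t) (k : nat -> L) :
  (forall j n, (j <= n)%N -> lim_proj (t j) (k n) = 1) ->
  exists x : nat -> L, forall n, x n = k n * x n.+1 ^+ n.+1.
Proof.
move=> k1.
(* [p m n] truncates the infinite product; in [G (t j)] it no longer changes once
   [j <= n + m]. *)
pose p := fix p m n : L := if m is l.+1 then k n * p l n.+1 ^+ n.+1 else 1.
have pS j m n : (j <= n + m)%N -> lim_proj (t j) (p m.+1 n) = lim_proj (t j) (p m n).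
  elim: m n => [|m IH] n jn.
    by rewrite -[p 1%N n]/(k n * 1 ^+ n.+1) expg1n mulg1 k1 // -(addn0 n).
  rewrite -[p m.+2 n]/(k n * p m.+1 n.+1 ^+ n.+1) -[in RHS]/(k n * p m n.+1 ^+ n.+1).
  by rewrite !lim_projM !lim_projX IH // addSnnS.
(* Depth [j] suffices in [G (t j)] for every [n], since [j <= n + j]. *)
have /choice[x xE] : forall n, exists x : L, forall j,
    lim_proj (t j) x = lim_proj (t j) (p j n).
  move=> n; apply: (lim_of_chain tC (fun j => lim_proj (t j) (p j n))) => j.
  by rewrite dmap_proj pS // leq_addl.
exists x => n; apply: (lim_ext_chain _ _ tC) => j.
(* The right-hand side is the truncation [p j.+1 n], which agrees with [p j n] in [G (t j)]. *)
by rewrite lim_projM lim_projX !xE -(pS j j n) ?leq_addl // -lim_projX -lim_projM.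
Qed.

Lemma Ab_lim_solve : countable [set: T] -> directed T ->
  (forall s, perfect (G s)) -> mittag_leffler G ->
  forall a : nat -> Ab L, exists x : nat -> Ab L,
    forall n, x n = (a n + x n.+1 *+ n.+1)%R.
Proof.
move=> cT dT pG ml a.
(* The chain needs a starting index; for empty [T] the limit is trivial. *)
have [[t0]|T0] := pselect (inhabited T); last first.
  have Ab0 (b : Ab L) : b = 0%R.
    rewrite -[b]reprK; congr (\pi_(Ab L)%qT _).
    by apply: lim_ext => t; case: T0; exists.
  by exists (fun=> 0%R) => n; rewrite (Ab0 (a n)) GRing.mul0rn GRing.addr0.
have [t [tC tP]] := exists_stable_chain cT dT ml t0.
have /choice[c cP] : forall n, exists c,
    commutator_subgroup L c /\ lim_proj (t n) c = lim_proj (t n) (repr (a n)).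
  by move=> n; have [c] := lim_proj_commutator tP pG n (repr (a n)); exists c.
have [|x xS] := lim_solve tC (fun n => (c n)^-1 * repr (a n)).
  move=> j n jn; rewrite -(dmap_proj _ _ (chain_le tC j n jn)).
  by rewrite lim_projM lim_projV (cP n).2 mulVg gmulf1.
exists (fun n => \pi_(Ab L)%qT (x n)) => n.
(* Passing to [Ab L] kills [c n], so the factor [(c n)^-1 * repr (a n)] has class [a n]. *)
rewrite [in LHS]xS Ab_piD Ab_piX; congr (_ + _)%R.
rewrite -[RHS]reprK; apply/Ab_piP; rewrite mulgK.
exact: commutator_subgroupV (cP n).1.
Qed.

End Limit.

Theorem corollary0p0p3 (disp : Order.disp_t) (T : porderType disp)
    (G : diagram T) (countable_T : countable [set: T])
    (directed_T : directed T) (perfect_G : forall t : T, perfect (G t))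
    (ML_G : mittag_leffler G) :
  cotorsion (Ab (inv_lim G)).
Proof. exact/cotorsion_of_solvable/Ab_lim_solve. Qed.
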